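(* Let $V\in L^\infty(\mathbb{R})$ with $\operatorname{ess\,inf}_{x\in\mathbb{R}}V(x)>0$, and suppose that $$m(V)=\lim_{a\to\infty}F(a;V)\quad\text{or}\quad m(V)=\lim_{a\to-\infty}F(a;V).$$ Let $p\in[1,\infty)$ and let $\mu\in L^p(\mathbb{R})+\mathcal{M}_1(\mathbb{R})$ be nonnegative in the sense that $\mu(u,u)\ge0$ for all $u\in H^1(\mathbb{R})$. Then $m(V+\mu)=m(V)$ and $M(V+\mu)\subset M(V)$.
   Context: Elements of $H^1(\mathbb{R})$ are identified with their continuous representatives; $\|u\|_\infty:=\|u\|_{L^\infty(\mathbb{R})}$. Let $X$ be the Banach space of all bounded symmetric bilinear maps $V:H^1(\mathbb{R})\times H^1(\mathbb{R})\to\mathbb{R}$. A function $W\in L^q(\mathbb{R})$ ($1\le q\le\infty$) is regarded as an element of $X$ via $W(u,v):=\int_{\mathbb{R}}W uv\,dx$; $\mathcal{M}_1(\mathbb{R})$ is the set of signed Radon measures on $\mathbb{R}$ with finite total variation, regarded as elements of $X$ via $\mu(u,v):=\int_{\mathbb{R}}uv\,d\mu$; $L^p(\mathbb{R})+\mathcal{M}_1(\mathbb{R})$ denotes the set of sums $\mu_0+\mu_1\in X$ with $\mu_0\in L^p(\mathbb{R})$, $\mu_1\in\mathcal{M}_1(\mathbb{R})$. For $V\in X$ and $u\in H^1(\mathbb{R})$ set $I(u;V):=\|u'\|_{L^2(\mathbb{R})}^2+V(u,u)$, $m(V):=\inf_{u\in H^1(\mathbb{R}),\,u\not\equiv0}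 I(u;V)/\|u\|_\infty^2$, and $M(V):=\{u\in H^1(\mathbb{R})\setminus\{0\}: I(u;V)/\|u\|_\infty^2=m(V)\}$. For $a\in\mathbb{R}$ let $K_a:=\{u\in H^1(\mathbb{R}):u(a)=\|u\|_\infty=1\}$ and $F(a;V):=\inf_{u\in K_a}I(u;V)$. *)

(* Defs.v *)
From HB Require Import structures.
From mathcomp Require Import all_boot all_order all_algebra.
From mathcomp Require Import all_classical all_reals all_analysis ess_sup_inf.
Set Implicit Arguments. Unset Strict Implicit. Unset Printing Implicit Defensive.
Import Order.TTheory GRing.Theory Num.Theory.
Import numFieldNormedType.Exports.
Local Open Scope classical_set_scope.
Local Open Scope ring_scope.

Section H1defs.
Variable R : realType.
Local Notation leb := (@lebesgue_measure R).

(* g is (a representative of) the weak derivative of u, in L^2: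
   g is measurable, square integrable, and u(y) - u(x) = int_[x,y] g. *)
Definition is_L2_deriv (u g : R -> R) : Prop :=
  measurable_fun setT g /\
  (\int[leb]_x ((g x) ^+ 2)%:E < +oo)%E /\
  forall x y : R, x <= y -> u y - u x = \int[leb]_(t in `[x, y]) g t.

(* H^1(R), elements identified with their continuous representatives *)
Definition H1 (u : R -> R) : Prop :=
  measurable_fun setT u /\
  (\int[leb]_x ((u x) ^+ 2)%:E < +oo)%E /\
  exists g, is_L2_deriv u g.

(* ||u'||_{L^2}^2 ; all L^2-derivatives of u agree a.e., so this is the value *)
Definition dnorm2 (u : R -> R) : \bar R :=
  ereal_inf [set (\int[leb]_x ((g x) ^+ 2)%:E)%E | g in is_L2_deriv u].

(* ||u||_oo (sup of |u|, u continuous) *)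
Definition supnorm (u : R -> R) : R := sup [set `|u x| | x in [set: R]].

Definition potQ (W : R -> R) (u : R -> R) : \bar R :=
  \int[leb]_x (W x * (u x) ^+ 2)%:E.
Definition measQ (nu : {measure set R -> \bar R}) (u : R -> R) : \bar R :=
  \int[nu]_x ((u x) ^+ 2)%:E.

(* A general element V of X is used only through its quadratic form Q u = V(u,u) *)
Definition Ifun (Q : (R -> R) -> \bar R) (u : R -> R) : \bar R :=
  (dnorm2 u + Q u)%E.

Definition ratio (Q : (R -> R) -> \bar R) (u : R -> R) : \bar R :=
  (Ifun Q u * ((supnorm u) ^- 2)%:E)%E.

Definition mval (Q : (R -> R) -> \bar R) : \bar R :=
  ereal_inf [set ratio Q u | u in [set u | H1 u /\ u <> (fun=> 0)]].

Definition Mset (Q : (R -> R) -> \bar R) : set (R -> R) :=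
  [set u | H1 u /\ u <> (fun=> 0) /\ ratio Q u = mval Q].

Definition Kset (a : R) : set (R -> R) :=
  [set u | H1 u /\ u a = 1 /\ supnorm u = 1].

Definition Fval (Q : (R -> R) -> \bar R) (a : R) : \bar R :=
  ereal_inf [set Ifun Q u | u in Kset a].

Definition Linfty (V : R -> R) : Prop :=
  measurable_fun setT V /\ (ess_sup leb (fun x => (`|V x|)%:E) < +oo)%E.

Definition ess_inf_pos (V : R -> R) : Prop :=
  (0 < ess_inf leb (fun x => (V x)%:E))%E.

Definition Lp (p : R) (W : R -> R) : Prop :=
  measurable_fun setT W /\ (\int[leb]_x ((`|W x| `^ p)%:E) < +oo)%E.

End H1defs.

(* Main.v *)
Require Import Defs.
From HB Require Import structures.
From mathcomp Require Import all_boot all_order all_algebra.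
From mathcomp Require Import all_classical all_reals all_analysis ess_sup_inf.
From mathcomp Require Import measurable_realfun ring lra.
Import Order.TTheory GRing.Theory Num.Theory.
Import numFieldNormedType.Exports.
Local Open Scope classical_set_scope.
Local Open Scope ring_scope.

(** Nonnegativity of mu gives m(V) <= m(V + mu), and the inclusion of the
    minimiser sets once the two values agree.  For the converse inequality take
    |a| large and u in K_a with I(u; V) close to m(V).  Since V >= c > 0 a.e.,
    the L^2 norm of u is bounded independently of a, so |u| <= d at some point
    on each side of a, within a distance L that depends on d only.  Replacing u
    beyond these two points by affine pieces of length 1 descending to 0 yields
    v in K_a with I(v; V) <= I(u; V) + O(d^2), supported in
    [a - L - 1, a + L + 1].  As |v| <= 1 and this window escapes to infinity
    with a at fixed length, mu(v, v) tends to 0. *)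

Set Implicit Arguments.
Unset Strict Implicit.

(** * Primitives of locally integrable functions and their gluing *)

Section Primitives.
Context {R : realType}.
Local Notation leb := (@lebesgue_measure R).

Lemma lebesgue_itvcc (x y : R) : x <= y -> leb `[x, y] = (y - x)%:E.
Proof.
rewrite lebesgue_measure_itv/= lte_fin le_eqVlt => /predU1P[->|->//].
by rewrite ltxx subrr.
Qed.

Lemma integrable_cst_itvcc (k x y : R) :
  leb.-integrable `[x, y] (EFin \o cst k).
Proof.
apply: measurable_bounded_integrable => //.
  by rewrite /= lebesgue_measure_itv/=; case: ifP => // _; rewrite -EFinB ltry.
exact: bounded_cst.
Qed.

(** Pointwise [|g| <= g^2 + 1], and the right-hand side is integrable on a bounded interval. *)
Lemma sqr_locally_integrable (g : R -> R) (x y : R) :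
  measurable_fun setT g -> (\int[leb]_x ((g x) ^+ 2)%:E < +oo)%E ->
  leb.-integrable `[x, y] (EFin \o g).
Proof.
move=> mg ig.
have i2 : leb.-integrable `[x, y] (EFin \o (fun t => (g t) ^+ 2)).
  apply: (@integrableS _ _ _ leb setT) => //.
  apply/integrableP; split.
    by apply/measurable_EFinP; exact: measurable_funX.
  by under eq_integral do rewrite /= ger0_norm ?sqr_ge0//.
have i1 := integrable_cst_itvcc 1 x y.
have mg' : measurable_fun `[x, y] (EFin \o g).
  by apply/measurable_EFinP; exact: measurable_funTS.
have := integrableD (mu := leb) (measurable_itv `[x, y]) i2 i1.
apply: le_integrable => // t _ /=.
rewrite lee_fin [leRHS]ger0_norm; last by rewrite addr_ge0 ?sqr_ge0.
rewrite -(real_normK (num_real (g t))).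
by have := sqr_ge0 (`|g t| - 1); nra.
Qed.

Lemma Rintegral_itvoc (f : R -> R) (x y : R) :
  leb.-integrable `[x, y] (EFin \o f) ->
  \int[leb]_(t in `[x, y]) f t = \int[leb]_(t in `]x, y]) f t.
Proof.
move=> fi; rewrite -Rintegral_itv_obnd_cbnd//.
by apply: integrableS fi => //; apply: subset_itvr; rewrite bnd_simp.
Qed.

(** Only local integrability is asked of [g], so that affine functions with nonzero slope, whose
    derivative is not in L^2 of the line, can serve as pieces of a gluing. *)
Definition primitive (u g : R -> R) :=
  [/\ measurable_fun setT u, measurable_fun setT g &
   forall x y : R, x <= y -> leb.-integrable `[x, y] (EFin \o g) /\
     u y - u x = \int[leb]_(t in `[x, y]) g t].

Definition split_at (c : R) (f1 f2 : R -> R) (x : R) :=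
  if x <= c then f1 x else f2 x.

Lemma measurable_split_at (c : R) (f1 f2 : R -> R) :
  measurable_fun setT f1 -> measurable_fun setT f2 ->
  measurable_fun setT (split_at c f1 f2).
Proof.
move=> m1 m2; apply: measurable_fun_ifT => //.
exact: measurable_fun_ler.
Qed.

(** On either side of [c] the increment formula is inherited; across [c] the two increments
    telescope because the values agree there. *)
Lemma primitive_split_at (c : R) (u1 u2 g1 g2 : R -> R) :
  primitive u1 g1 -> primitive u2 g2 -> u1 c = u2 c ->
  primitive (split_at c u1 u2) (split_at c g1 g2).
Proof.
move=> [mu1 mg1 p1] [mu2 mg2 p2] uc.
split; [exact: measurable_split_at..|].
have intg x y : x <= y -> leb.-integrable `[x, y] (EFin \o split_at c g1 g2).
  move=> xy; have [i1 _] := p1 _ _ xy; have [i2 _] := p2 _ _ xy.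
  have mg : measurable_fun `[x, y] (EFin \o split_at c g1 g2).
    by apply/measurable_EFinP; apply: measurable_funTS; exact: measurable_split_at.
  have := integrableD (mu := leb) (measurable_itv `[x, y]) (integrable_norm i1) (integrable_norm i2).
  apply: le_integrable => // t _ /=.
  rewrite lee_fin [leRHS]ger0_norm ?addr_ge0//.
  by rewrite /split_at; case: ifP => _; rewrite (lerDl, lerDr).
have left x y : x <= y -> y <= c ->
    \int[leb]_(t in `[x, y]) split_at c g1 g2 t = u1 y - u1 x.
  move=> xy yc; have [_ ->] := p1 _ _ xy.
  apply: eq_Rintegral => t; rewrite inE/= in_itv/= => /andP[_ ty].
  by rewrite /split_at (le_trans ty yc).
have right x y : x <= y -> c <= x ->
    \int[leb]_(t in `[x, y]) split_at c g1 g2 t = u2 y - u2 x.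
  move=> xy cx; have [_ ->] := p2 _ _ xy.
  (* When [x = c] the glued integrand takes its left value at [x], so this endpoint is removed
     before comparing with [g2]. *)
  rewrite (Rintegral_itvoc (intg _ _ xy)) (Rintegral_itvoc (p2 _ _ xy).1).
  apply: eq_Rintegral => t; rewrite inE/= in_itv/= => /andP[xt _].
  by rewrite /split_at leNgt (le_lt_trans cx xt).
move=> x y xy; split; first exact: intg.
have [yc|cy] := leP y c.
  by rewrite left// /split_at yc (le_trans xy yc).
have [xc|cx] := leP x c; last first.
  by rewrite right ?(ltW cx)// /split_at !leNgt cx cy.
have := @Rintegral_itvB R (split_at c g1 g2) (BLeft x) (BRight y) c (intg _ _ xy).
rewrite !bnd_simp => /(_ xc (ltW cy)).
rewrite -Rintegral_itvoc; last exact: intg (ltW cy).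
rewrite (left x c xc (lexx c)) (right c y (ltW cy) (lexx c)) => E.
have -> : split_at c u1 u2 y = u2 y by rewrite /split_at leNgt cy.
have -> : split_at c u1 u2 x = u1 x by rewrite /split_at xc.
by rewrite -[RHS](subrK (u1 c - u1 x)) E uc; ring.
Qed.

Lemma primitive_linear (k b : R) : primitive (fun x => k * (x - b)) (cst k).
Proof.
split => //.
  by apply: measurable_funM => //; apply: measurable_funB.
move=> x y xy; split; first exact: integrable_cst_itvcc.
by rewrite Rintegral_cst//= lebesgue_itvcc//=; ring.
Qed.

End Primitives.

(** * Truncation to a window around [a] *)

Section Truncation.
Context {R : realType}.
Local Notation leb := (@lebesgue_measure R).

(* Dominates, up to the factor d^2, the change of u^2 and u'^2 caused by the two
   affine pieces, which live on [b1, b1 + 1] and [b2, b2 + 1]. *)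
Definition bumps (b1 b2 x : R) : R :=
  \1_(`[b1, b1 + 1]) x + \1_(`[b2, b2 + 1]) x.

Lemma bumps_ge0 (b1 b2 x : R) : 0 <= bumps b1 b2 x.
Proof. by rewrite addr_ge0. Qed.

Lemma bumps_ge1l (b1 b2 x : R) : b1 <= x <= b1 + 1 -> 1 <= bumps b1 b2 x.
Proof.
by move=> h; rewrite /bumps [X in X + _]indicE mem_setE in_itv/= h lerDl.
Qed.

Lemma bumps_ge1r (b1 b2 x : R) : b2 <= x <= b2 + 1 -> 1 <= bumps b1 b2 x.
Proof.
by move=> h; rewrite /bumps [X in _ + X]indicE mem_setE in_itv/= h lerDr.
Qed.

Lemma measurable_bumps (b1 b2 : R) : measurable_fun setT (bumps b1 b2).
Proof. by apply: measurable_funD => //; exact: measurable_indic. Qed.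

Lemma integral_bumps (b1 b2 : R) : (\int[leb]_x (bumps b1 b2 x)%:E = 2%:E)%E.
Proof.
under eq_integral do rewrite EFinD.
rewrite ge0_integralD//=; last 2 first.
- by apply/measurable_EFinP; exact: measurable_indic.
- by apply/measurable_EFinP; exact: measurable_indic.
rewrite !integral_indic// !setIT.
rewrite /= !lebesgue_itvcc ?lerDl//.
by rewrite -EFinD; congr (_%:E); ring.
Qed.

Lemma integral_le_bumps (f1 f2 : R -> R) (k b1 b2 : R) : 0 <= k ->
  measurable_fun setT f1 -> measurable_fun setT f2 ->
  (forall x, 0 <= f1 x) -> (forall x, 0 <= f2 x) ->
  (forall x, f1 x <= f2 x + k * bumps b1 b2 x) ->
  (\int[leb]_x (f1 x)%:E <= \int[leb]_x (f2 x)%:E + (2 * k)%:E)%E.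
Proof.
move=> k0 m1 m2 f10 f20 f12.
have -> : ((2 * k)%:E = \int[leb]_x (k * bumps b1 b2 x)%:E)%E.
  under eq_integral do rewrite EFinM.
  rewrite ge0_integralZl//; last 2 first.
  - by apply/measurable_EFinP; exact: measurable_bumps.
  - by move=> x _; rewrite lee_fin bumps_ge0.
  by rewrite integral_bumps -EFinM mulrC.
rewrite -ge0_integralD//; last 4 first.
- by move=> x _; rewrite lee_fin.
- exact/measurable_EFinP.
- by move=> x _; rewrite lee_fin mulr_ge0// bumps_ge0.
- by apply/measurable_EFinP/measurable_funM => //; exact: measurable_bumps.
apply: ge0_le_integral => //.
- by move=> x _; rewrite lee_fin.
- exact/measurable_EFinP.
- by apply: emeasurable_funD; apply/measurable_EFinP => //; apply: measurable_funM => //; exact: measurable_bumps.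
- by move=> x _; rewrite -EFinD lee_fin.
Qed.

(** Chebyshev: if [|u| > d] on the whole interval, the integral of [u^2] would be at least
    [d^2 * L], which exceeds [C]. *)
Lemma exists_small_point (u : R -> R) (b L C d : R) :
  measurable_fun setT u -> 0 < L -> 0 < d ->
  (\int[leb]_x ((u x) ^+ 2)%:E <= C%:E)%E -> C < d ^+ 2 * L ->
  exists2 t, b <= t <= b + L & `|u t| <= d.
Proof.
move=> mu L0 d0 uC CL; apply/not_exists2P => h.
suff : ((d ^+ 2 * L)%:E <= C%:E)%E by rewrite lee_fin leNgt CL.
apply: le_trans uC.
have -> : ((d ^+ 2 * L)%:E = \int[leb]_(x in `[b, (b + L)%R]) (cst (d ^+ 2)%:E x))%E.
  rewrite integral_cst//= lebesgue_itvcc ?lerDl ?ltW// -EFinM.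
  by congr (_%:E); ring.
have mu2 : measurable_fun setT (fun x => ((u x) ^+ 2)%:E).
  by apply/measurable_EFinP; exact: measurable_funX.
apply: (@le_trans _ _ (\int[leb]_(x in `[b, (b + L)%R]) ((u x) ^+ 2)%:E)%E).
  apply: ge0_le_integral => //=.
  - by move=> x _; rewrite lee_fin sqr_ge0.
  - exact: measurable_funTS.
  - move=> x; rewrite in_itv/= => xb; rewrite lee_fin.
    have [//|/negP] := h x.
    rewrite -ltNge => du.
    by rewrite -(real_normK (num_real (u x))); nra.
apply: ge0_subset_integral => //.
by move=> x _; rewrite lee_fin sqr_ge0.
Qed.

Lemma primitive_truncate (u g : R -> R) (a L C d : R) :
  primitive u g -> 0 < L -> 0 < d -> (forall x, `|u x| <= 1) ->
  (\int[leb]_x ((u x) ^+ 2)%:E <= C%:E)%E -> C < d ^+ 2 * L ->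
  exists v h b1 b2, [/\ primitive v h, v a = u a,
   forall x, (h x) ^+ 2 <= (g x) ^+ 2 + d ^+ 2 * bumps b1 b2 x,
   forall x, (v x) ^+ 2 <= (u x) ^+ 2 + d ^+ 2 * bumps b1 b2 x &
   forall x, `|v x| <= 1 /\ (L + 1 < `|x - a| -> v x = 0)].
Proof.
move=> ug L0 d0 u1 uC CL.
have mu : measurable_fun setT u by case: ug.
have [l] := exists_small_point (a - L) mu L0 d0 uC CL.
rewrite subrK => /andP[al la] ul.
have [r /andP[ar ra] ur] := exists_small_point a mu L0 d0 uC CL.
(* The zero function, in the shape required by [primitive_linear]. *)
pose zero : R -> R := fun x => 0 * (x - 0).
(* [linl] joins 0 at [l - 1] to [u l] at [l], and [linr] joins [u r] at [r] to 0 at [r + 1]; having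
   length 1, they have slopes of size at most [d]. *)
pose linl : R -> R := fun x => u l * (x - (l - 1)).
pose linr : R -> R := fun x => - u r * (x - (r + 1)).
pose v := split_at (l - 1) zero (split_at l linl (split_at r u (split_at (r + 1) linr zero))).
pose h := split_at (l - 1) (cst 0) (split_at l (cst (u l)) (split_at r g
  (split_at (r + 1) (cst (- u r)) (cst 0)))).
have vh : primitive v h.
  have lr := le_trans la ar.
  have ll : l - 1 <= l by lra.
  have rr : r <= r + 1 by lra.
  apply: primitive_split_at; first exact: primitive_linear.
    apply: primitive_split_at; first exact: primitive_linear.
      apply: primitive_split_at => //.
        apply: primitive_split_at; try exact: primitive_linear.
        by rewrite /zero /linr; ring.
      by rewrite /split_at rr /linr; ring.
    by rewrite /split_at lr /linl; ring.
  by rewrite /split_at ll /zero /linl; ring.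
have sq_le (x y : R) : `|x| <= y -> x ^+ 2 <= y ^+ 2.
  move=> xy; rewrite -(real_normK (num_real x)) lerXn2r ?nnegrE//.
  exact: le_trans xy.
have leb1 (x y : R) : x ^+ 2 <= d ^+ 2 -> 1 <= y -> forall z : R, x ^+ 2 <= z ^+ 2 + d ^+ 2 * y.
  move=> xd y1 z; have := sqr_ge0 z; have := sqr_ge0 d; nra.
have leb2 (x y : R) : 0 <= y -> x ^+ 2 <= x ^+ 2 + d ^+ 2 * y.
  by move=> y0; rewrite lerDl mulr_ge0// sqr_ge0.
(* On its interval each affine piece is an endpoint value of [u] times a factor in [0, 1], hence
   inherits both the bound [d] and the bound 1. *)
have small (x k : R) : `|x| <= d -> `|x| <= 1 -> 0 <= k <= 1 ->
    `|x * k| <= d /\ `|x * k| <= 1.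
  move=> xd x1 /andP[k0 k1]; rewrite normrM (ger0_norm k0).
  by have := normr_ge0 x; split; nra.
exists v, h, (l - 1), r; split => //.
- rewrite /v /split_at; have -> : (a <= l - 1) = false by apply/negbTE; rewrite -ltNge; lra.
  (* If [a = l], the point [a] falls into the branch of [linl], whose value there is [u l]. *)
  have [al'|la'] := leP a l; last by rewrite ar.
  have -> : a = l by apply/eqP; rewrite eq_le al' la.
  by rewrite /linl; ring.
- move=> x; rewrite /h /split_at.
  have b0 := bumps_ge0 (l - 1) r x.
  have z0 : (0 : R) ^+ 2 <= (g x) ^+ 2 + d ^+ 2 * bumps (l - 1) r x.
    by have := sqr_ge0 (g x); have := sqr_ge0 d; nra.
  case: (leP x (l - 1)) => x1; first exact: z0.
  case: (leP x l) => x2.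
    apply: leb1; first exact: sq_le.
    by apply: bumps_ge1l; lra.
  case: (leP x r) => x3; first exact: leb2.
  case: (leP x (r + 1)) => x4; last exact: z0.
  apply: leb1; first by apply: sq_le; rewrite normrN.
  by apply: bumps_ge1r; lra.
- move=> x; rewrite /v /split_at.
  have b0 := bumps_ge0 (l - 1) r x.
  have z0 : (zero x) ^+ 2 <= (u x) ^+ 2 + d ^+ 2 * bumps (l - 1) r x.
    by rewrite /zero mul0r; have := sqr_ge0 (u x); have := sqr_ge0 d; nra.
  case: (leP x (l - 1)) => x1; first exact: z0.
  case: (leP x l) => x2.
    apply: leb1; last by apply: bumps_ge1l; lra.
    by apply: sq_le; apply: (small _ _ ul (u1 l) _).1; lra.
  case: (leP x r) => x3; first exact: leb2.
  case: (leP x (r + 1)) => x4; last exact: z0.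
  apply: leb1; last by apply: bumps_ge1r; lra.
  apply: sq_le; rewrite /linr mulNr -mulrN.
  by apply: (small _ _ ur (u1 r) _).1; lra.
- move=> x; rewrite /v /split_at.
  split.
    case: (leP x (l - 1)) => x1; first by rewrite /zero mul0r normr0.
    case: (leP x l) => x2; first by apply: (small _ _ ul (u1 l) _).2; lra.
    case: (leP x r) => x3; first exact: u1.
    case: (leP x (r + 1)) => x4; last by rewrite /zero mul0r normr0.
    rewrite /linr mulNr -mulrN.
    by apply: (small _ _ ur (u1 r) _).2; lra.
  (* Since [a - L <= l] and [r <= a + L], such an [x] lies beyond [r + 1] or before [l - 1]. *)
  rewrite ltr_normr => /orP[] xa.
    have -> : (x <= l - 1) = false by apply/negbTE; rewrite -ltNge; lra.
    have -> : (x <= l) = false by apply/negbTE; rewrite -ltNge; lra.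
    have -> : (x <= r) = false by apply/negbTE; rewrite -ltNge; lra.
    have -> : (x <= r + 1) = false by apply/negbTE; rewrite -ltNge; lra.
    by rewrite /zero mul0r.
  have -> : x <= l - 1 by lra.
  by rewrite /zero mul0r.
Qed.

End Truncation.

(** * Smallness of integrals far from the origin *)

Section Tails.
Context {R : realType}.
Local Notation leb := (@lebesgue_measure R).

(* [phi] measures how far a point is; the applications use [phi = id]. *)
Lemma integral_tail d (T : measurableType d) (nu : {measure set T -> \bar R})
    (phi f : T -> R) (e : R) :
  measurable_fun setT phi -> measurable_fun setT f -> (forall x, 0 <= f x) ->
  (\int[nu]_x (f x)%:E < +oo)%E -> 0 < e ->
  exists M : R, forall A, measurable A -> (forall x, A x -> M <= `|phi x|) ->
    (\int[nu]_(x in A) (f x)%:E <= e%:E)%E.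
Proof.
move=> mphi mf f0 fi e0.
pose E (n : nat) := [set x | n%:R <= `|phi x|].
have mE n : measurable (E n).
  have -> : E n = [set: T] `&` (Num.norm \o phi) @^-1` `[n%:R, +oo[.
    by rewrite setTI; apply/seteqP; split => x; rewrite /E/= in_itv/= andbT.
  have : measurable_fun setT (Num.norm \o phi) by exact: measurableT_comp.
  by apply => //; exact: measurable_itv.
have mf' : measurable_fun setT (EFin \o f) by exact/measurable_EFinP.
have fint : nu.-integrable setT (EFin \o f).
  apply/integrableP; split => //.
  by under eq_integral do rewrite /= ger0_norm//.
have mfE n : measurable_fun setT ((EFin \o f) \_ (E n)).
  by apply/(measurable_restrictT _ (mE n)); exact: measurable_funTS.
(* A point leaves [E n] once [n] exceeds [|phi x|], so the restrictions of [f] vanish eventually;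
   [f] itself dominates them. *)
have fE0 : \forall x \ae nu, [set: T] x ->
    ((EFin \o f) \_ (E n)) x @[n --> \oo] --> (cst 0%E : T -> \bar R) x.
  apply: aeW => x _; apply: cvg_near_cst.
  near=> n; rewrite patchE memNset// /E/=; apply/negP; rewrite -ltNge.
  by near: n; exact: nbhs_infty_gtr.
have fEf : \forall x \ae nu, forall n, [set: T] x ->
    (`|((EFin \o f) \_ (E n)) x| <= (EFin \o f) x)%E.
  apply: aeW => x n _; rewrite patchE; case: ifP => _.
    by rewrite /= lee_fin ger0_norm.
  by rewrite abse0 lee_fin.
have [_ _] := dominated_convergence measurableT mfE (measurable_cst _) fE0 fint fEf.
rewrite integral0 => /fine_cvgP[+ ].
move=> fin /cvgr_lt -/(_ _ e0) small.
pose I n := (\int[nu]_x ((EFin \o f) \_ (E n)) x)%E.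
have [n [finn smalln]] : exists n, I n \is a fin_num /\ fine (I n) < e.
  near \oo => n; exists n; split; near: n; [exact: fin|exact: small].
exists n%:R => A mA AE.
apply: (@le_trans _ _ (I n)).
  rewrite /I -integral_mkcond; apply: ge0_subset_integral => //.
  - exact: measurable_funTS.
  - by move=> x _; rewrite lee_fin.
by rewrite -(fineK finn) lee_fin ltW.
Unshelve. all: by end_near. Qed.

(* Linearises [w] against [w `^ p], which replaces Hoelder's inequality on an
   interval of bounded length. *)
Lemma le_powR_linear (p k w : R) : 1 <= p -> 0 < k -> 0 <= w ->
  w <= k + k * k^-1 `^ p * w `^ p.
Proof.
move=> p1 k0 w0; have [wk|kw] := leP w k.
  apply: le_trans wk _; rewrite lerDl !mulr_ge0 ?powR_ge0//; exact: ltW.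
(* Above [k] the quotient [w / k] is at least 1, hence at most its [p]-th power. *)
have q1 : 1 <= k^-1 * w by rewrite mulrC ler_pdivlMr// mul1r ltW.
have := le1r_powRZ q1 ler01 p1.
rewrite powR1 !mulr1 powRM ?invr_ge0 ?(ltW k0)// ler_pdivrMl//.
by rewrite mulrA => /le_trans; apply; rewrite lerDr ltW.
Qed.

Lemma Lp_tail (p l e : R) (W : R -> R) : 1 <= p -> Lp p W -> 0 < l -> 0 < e ->
  exists M : R, forall b, (forall x, b <= x <= b + l -> M <= `|x|) ->
    (\int[leb]_(x in `[b, (b + l)%R]) (`|W x|)%:E <= e%:E)%E.
Proof.
move=> p1 [mW Wp] l0 e0.
(* Over length [l] the constant [k] contributes [e / 2]; the tail of [|W|^p], made smaller than
   [e / (2 * c)], contributes the other half. *)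
pose k := e / (2 * l).
have k0 : 0 < k by rewrite divr_gt0// mulr_gt0.
pose c := k * k^-1 `^ p.
have c0 : 0 < c by rewrite mulr_gt0// powR_gt0// invr_gt0.
have mWp : measurable_fun setT (fun x => `|W x| `^ p).
  by apply: (measurableT_comp (@measurable_powR R p)); exact: measurableT_comp.
have Wp0 x : 0 <= `|W x| `^ p by exact: powR_ge0.
have ec0 : 0 < e / (2 * c) by rewrite divr_gt0// mulr_gt0.
have [M tail] := integral_tail (nu := leb) (measurable_id (D := setT)) mWp Wp0 Wp ec0.
exists M => b bM.
apply: (@le_trans _ _ (\int[leb]_(x in `[b, (b + l)%R]) (k%:E + c%:E * (`|W x| `^ p)%:E))%E).
  apply: ge0_le_integral => //.
  - by apply/measurable_EFinP; apply: measurable_funTS; exact: measurableT_comp.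
  - apply: emeasurable_funD => //; apply: measurable_funeM.
    by apply/measurable_EFinP; exact: measurable_funTS.
  - by move=> x _; rewrite -EFinM -EFinD lee_fin; exact: le_powR_linear.
rewrite ge0_integralD//; last 3 first.
- by move=> x _; rewrite lee_fin ltW.
- by move=> x _; rewrite -EFinM lee_fin mulr_ge0 ?powR_ge0// ltW.
- by apply: measurable_funeM; apply/measurable_EFinP; exact: measurable_funTS.
rewrite ge0_integralZl//; last 2 first.
- by apply/measurable_EFinP; exact: measurable_funTS.
- by rewrite lee_fin ltW.
rewrite integral_cst//= lebesgue_itvcc ?lerDl ?(ltW l0)//.
have -> : (e%:E = k%:E * (b + l - b)%:E + c%:E * (e / (2 * c))%:E)%E.
  by rewrite -!EFinM -EFinD; congr (_%:E); rewrite /k; field; rewrite !gt_eqF.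
apply: leeD => //; apply: lee_wpmul2l; first by rewrite lee_fin ltW.
by apply: tail => // x; rewrite /= in_itv/=; exact: bM.
Qed.

End Tails.

(** * Bounds on the potential and localisation of near-minimisers *)

Section Potential.
Context {R : realType}.
Local Notation leb := (@lebesgue_measure R).

(** Clamping [V] between its essential bounds changes it on a null set only, which no integral sees,
    and makes the bounds hold everywhere. *)
Lemma potential_representative (V : R -> R) : Linfty V -> ess_inf_pos V ->
  exists (c B : R) (W : R -> R), [/\ 0 < c, measurable_fun setT W,
    forall x, c <= W x <= B &
    forall u : R -> R, measurable_fun setT u -> potQ V u = potQ W u].
Proof.
move=> [mV Vsup] Vinf.
have [c c0 cV] : exists2 c : R, 0 < c & \forall x \ae leb, c <= V x.
  move: Vinf (ess_inf_le leb (fun x => (V x)%:E)); rewrite /ess_inf_pos.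
  case: (ess_inf _ _) => [r| |]//= r0 h.
    by exists r; [rewrite -lte_fin|apply: filterS h => x; rewrite lee_fin].
  (* An infinite essential infimum would force the real number [V x] to be infinite almost
     everywhere, so any positive constant serves. *)
  by exists 1 => //; apply: filterS h => x; rewrite leye_eq.
have [B VB] : exists B : R, \forall x \ae leb, V x <= B.
  move: Vsup (ess_sup_ge leb (fun x => (`|V x|)%:E)).
  case: (ess_sup _ _) => [r| |]//= _ h.
    exists r; apply: filterS h => x; rewrite lee_fin; apply: le_trans.
    exact: ler_norm.
  by exists 0; apply: filterS h => x; rewrite leeNy_eq.
(* The upper bound is [max c B] because [c <= B] has not been established. *)
exists c, (Num.max c B), (fun x => Num.max c (Num.min (Num.max c B) (V x))).
have mW : measurable_fun setT (fun x => Num.max c (Num.min (Num.max c B) (V x))).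
  by apply: measurable_maxr => //; exact: measurable_minr.
split => //.
  by move=> x; rewrite le_max lexx/= ge_max le_max lexx/= ge_min lexx.
move=> u mu; apply: ae_eq_integral => //.
- by apply/measurable_EFinP; apply: measurable_funM => //; exact: measurable_funX.
- by apply/measurable_EFinP; apply: measurable_funM => //; exact: measurable_funX.
- have aeF := ae_filter_ringOfSetsType leb.
  apply: (filterS2 _ _ cV VB) => x cx xB _; congr (_%:E); congr (_ * _).
  by rewrite (min_r (y := V x)) ?le_max ?xB ?orbT// max_r.
Qed.

(** [sup] defaults to 0 on a set without supremum, so the value 1 already guarantees boundedness. *)
Lemma supnorm_eq1_le (u : R -> R) : supnorm u = 1 -> forall x, `|u x| <= 1.
Proof.
move=> u1 x; rewrite -u1 /supnorm.
have [hs|hs] := pselect (has_sup [set `|u y| | y in [set: R]]).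
  by apply: sup_ubound; [case: hs|exists x].
by move: u1; rewrite /supnorm sup_out// => /eqP; rewrite eq_sym oner_eq0.
Qed.

Lemma supnorm_eq1 (u : R -> R) (a : R) :
  u a = 1 -> (forall x, `|u x| <= 1) -> supnorm u = 1.
Proof.
move=> ua u1; apply/eqP; rewrite eq_le; apply/andP; split.
  apply: ge_sup; first by exists `|u a|, a.
  by move=> _ [x _ <-].
rewrite -[leLHS]normr1 -ua; apply: sup_ubound; last by exists a.
by exists 1 => _ [x _ <-].
Qed.

Lemma dnorm2_ge0 (u : R -> R) : (0 <= dnorm2 u)%E.
Proof.
apply: le_ereal_inf_tmp => _ [g _ <-].
by apply: integral_ge0 => x _; rewrite lee_fin sqr_ge0.
Qed.

Lemma is_L2_deriv_primitive (u g : R -> R) :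
  measurable_fun setT u -> is_L2_deriv u g -> primitive u g.
Proof.
move=> mu [mg [g2 ug]]; split => // x y xy; split; last exact: ug.
exact: sqr_locally_integrable.
Qed.

(** Truncation at level [d] costs at most [2 * d^2] in the derivative term and [2 * B * d^2] in the
    potential term. *)
Lemma Kset_localize (V W : R -> R) (c B : R) :
  0 < c -> measurable_fun setT W -> (forall x, c <= W x <= B) ->
  (forall u : R -> R, measurable_fun setT u -> potQ V u = potQ W u) ->
  forall (a t L d : R) (u : R -> R), Kset a u -> 0 < L -> 0 < d ->
  (Ifun (potQ V) u < t%:E)%E -> t / c < d ^+ 2 * L ->
  exists v, [/\ Kset a v, forall x, `|v x| <= 1,
    forall x, L + 1 < `|x - a| -> v x = 0 &
    (Ifun (potQ V) v <= (t + 2 * d ^+ 2 * (1 + B))%:E)%E].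
Proof.
move=> c0 mW cWB VW a t L d u [[mu [u2 [g0 g0P]]] [ua us]] L0 d0 ut tL.
have W0 x : 0 <= W x by have /andP[cW _] := cWB x; apply: le_trans cW; exact: ltW.
have B0 : 0 <= B by have /andP[_] := cWB 0; exact: le_trans.
have mu2 (f : R -> R) : measurable_fun setT f -> measurable_fun setT (fun x => f x ^+ 2).
  exact: measurable_funX.
have mWu2 (f : R -> R) : measurable_fun setT f -> measurable_fun setT (fun x => W x * f x ^+ 2).
  by move=> mf; apply: measurable_funM => //; exact: measurable_funX.
have Wu0 (f : R -> R) x : 0 <= W x * f x ^+ 2 by rewrite mulr_ge0// sqr_ge0.
have q0 (f : R -> R) : (0 <= potQ W f)%E.
  by apply: integral_ge0 => x _; rewrite lee_fin.
move: ut; rewrite /Ifun VW// => ut.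
have qfin : potQ W u \is a fin_num.
  rewrite ge0_fin_numE//; apply: le_lt_trans (lt_trans ut (ltry _)).
  by rewrite leeDr// dnorm2_ge0.
(* [dnorm2] is an infimum; the strict bound on [Ifun] leaves room for a derivative [g] whose total
   energy is still below [t]. *)
have [_ [g gP <-] gt] : exists2 y, [set (\int[leb]_x ((g x) ^+ 2)%:E)%E | g in is_L2_deriv u] y &
    (y < t%:E - potQ W u)%E.
  by apply: ereal_inf_lt; rewrite lteBrDr.
have {}gt : (\int[leb]_x ((g x) ^+ 2)%:E + potQ W u < t%:E)%E by rewrite -lteBrDr.
(* The lower bound on [W] gives c times the integral of [u^2] at most [potQ W u], hence at most [t],
   whatever [a] is. *)
have uC : (\int[leb]_x ((u x) ^+ 2)%:E <= (t / c)%:E)%E.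
  have /le_lt_trans/(_ gt)/ltW qt :
      (potQ W u <= \int[leb]_x ((g x) ^+ 2)%:E + potQ W u)%E.
    by rewrite leeDr// integral_ge0// => x _; rewrite lee_fin sqr_ge0.
  rewrite mulrC EFinM lee_pdivlMl//; apply: le_trans qt.
  rewrite -ge0_integralZl//; last 3 first.
  - by apply/measurable_EFinP; exact: mu2.
  - by move=> x _; rewrite lee_fin sqr_ge0.
  - by rewrite lee_fin ltW.
  apply: ge0_le_integral => //.
  - by move=> x _; rewrite lee_fin mulr_ge0 ?sqr_ge0// ltW.
  - by apply: measurable_funeM; apply/measurable_EFinP; exact: mu2.
  - by apply/measurable_EFinP; exact: mWu2.
  - move=> x _; rewrite lee_fin ler_wpM2r ?sqr_ge0//.
    by have /andP[] := cWB x.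
have ug := is_L2_deriv_primitive mu gP.
have [v [h [b1 [b2 [vh va hg vu vP]]]]] :=
  primitive_truncate a ug L0 d0 (supnorm_eq1_le us) uC tL.
have [mv mh vhP] := vh.
have [mg [g2 _]] := gP.
have d20 : 0 <= d ^+ 2 := sqr_ge0 d.
have v1 x : `|v x| <= 1 by have [] := vP x.
have hle : (\int[leb]_x ((h x) ^+ 2)%:E <=
            \int[leb]_x ((g x) ^+ 2)%:E + (2 * d ^+ 2)%:E)%E.
  by apply: integral_le_bumps hg => //; [exact: mu2|exact: mu2|move=> x; exact: sqr_ge0|move=> x; exact: sqr_ge0].
have vle : (\int[leb]_x ((v x) ^+ 2)%:E <=
            \int[leb]_x ((u x) ^+ 2)%:E + (2 * d ^+ 2)%:E)%E.
  by apply: integral_le_bumps vu => //; [exact: mu2|exact: mu2|move=> x; exact: sqr_ge0|move=> x; exact: sqr_ge0].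
have Wle : (potQ W v <= potQ W u + (2 * (B * d ^+ 2))%:E)%E.
  apply: (integral_le_bumps (b1 := b1) (b2 := b2)); [by rewrite mulr_ge0|exact: mWu2|exact: mWu2|exact: Wu0|exact: Wu0|].
  move=> x; have /andP[_ WB] := cWB x.
  apply: le_trans (ler_wpM2l (W0 x) (vu x)) _.
  rewrite mulrDr lerD2l -mulrA ler_wpM2r// mulr_ge0// bumps_ge0//.
have hP : is_L2_deriv v h.
  split=> //; split; last by move=> x y /vhP[].
  by apply: le_lt_trans hle _; rewrite lte_add_pinfty// ltry.
exists v; split => //.
- split.
    split => //; split; last by exists h.
    by apply: le_lt_trans vle _; rewrite lte_add_pinfty// ltry.
  by rewrite va; split => //; apply: (supnorm_eq1 (a := a)) => //; rewrite va.
- by move=> x; have [_] := vP x.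
- rewrite /Ifun VW//.
  have : (dnorm2 v <= \int[leb]_x ((h x) ^+ 2)%:E)%E by apply: ereal_inf_lbound; exists h.
  move=> /le_trans/(_ hle) dle.
  apply: le_trans (leeD dle Wle) _.
  rewrite addeACA -EFinD.
  have -> : t + 2 * d ^+ 2 * (1 + B) = t + (2 * d ^+ 2 + 2 * (B * d ^+ 2)) by ring.
  by rewrite [leRHS]EFinD leeD2r// ltW.
Qed.

Lemma potQ_local_le (W v : R -> R) (b l : R) :
  measurable_fun setT W -> measurable_fun setT v -> (forall x, `|v x| <= 1) ->
  (forall x, ~~ (b <= x <= b + l) -> v x = 0) ->
  (potQ W v <= \int[leb]_(x in `[b, (b + l)%R]) (`|W x|)%:E)%E.
Proof.
move=> mW mv v1 v0.
have mWv : measurable_fun setT (fun x => W x * v x ^+ 2).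
  by apply: measurable_funM => //; exact: measurable_funX.
apply: le_trans (lee_abs _) _; apply: le_trans (le_abse_integral _ _ _) _ => //.
  exact/measurable_EFinP.
rewrite [leRHS]integral_mkcond; apply: ge0_le_integral => //.
- by apply/measurable_EFinP; exact: measurableT_comp.
- apply: (measurable_restrictT (D := `[b, (b + l)%R]) _ _).1 => //.
  by apply/measurable_EFinP; apply: measurable_funTS; exact: measurableT_comp.
- move=> x _; rewrite patchE mem_setE in_itv/=; case: ifPn => xb.
    rewrite lee_fin normrM ler_piMr// normrX expr_le1//.
  by rewrite v0// expr0n mulr0 normr0.
Qed.

Lemma measQ_local_le (nu : {measure set R -> \bar R}) (v : R -> R) (b l : R) :
  measurable_fun setT v -> (forall x, `|v x| <= 1) ->
  (forall x, ~~ (b <= x <= b + l) -> v x = 0) ->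
  (measQ nu v <= \int[nu]_(x in `[b, (b + l)%R]) 1)%E.
Proof.
move=> mv v1 v0; rewrite [leRHS]integral_mkcond; apply: ge0_le_integral => //.
- by move=> x _; rewrite lee_fin sqr_ge0.
- by apply/measurable_EFinP; exact: measurable_funX.
- exact: (measurable_restrictT (D := `[b, (b + l)%R]) _ _).1.
- move=> x _; rewrite patchE mem_setE in_itv/=; case: ifPn => xb.
    by rewrite lee_fin -(real_normK (num_real (v x))) expr_le1.
  by rewrite v0// expr0n.
Qed.

End Potential.

(** * Comparison of the infima along escaping points *)

Section Escape.
Context {R : realType}.

Lemma ratio_ge0 (Q : (R -> R) -> \bar R) (u : R -> R) :
  (0 <= Q u)%E -> (0 <= Defs.ratio Q u)%E.
Proof.
move=> Qu; apply: mule_ge0; first by rewrite adde_ge0// dnorm2_ge0.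
by rewrite lee_fin invr_ge0 sqr_ge0.
Qed.

Lemma le_ratio (Q1 Q2 : (R -> R) -> \bar R) (u : R -> R) :
  (Q1 u <= Q2 u)%E -> (Defs.ratio Q1 u <= Defs.ratio Q2 u)%E.
Proof.
move=> Q12; apply: lee_wpmul2r; first by rewrite lee_fin invr_ge0 sqr_ge0.
exact: leeD2l.
Qed.

Lemma mval_le_Kset (Q : (R -> R) -> \bar R) (a : R) (u : R -> R) :
  Kset a u -> (mval Q <= Ifun Q u)%E.
Proof.
move=> [Hu [ua us]]; apply: ereal_inf_lbound; exists u.
  split => // u0; move: ua; rewrite u0 => /eqP.
  by rewrite eq_sym oner_eq0.
by rewrite /Defs.ratio us expr1n invr1 mule1.
Qed.

(** An abstract filter [F] escaping every bounded set treats both ends of the line at once. *)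
Lemma mval_escape (F : set_system R) (V mu0 : R -> R) (p : R)
    (nup num : {finite_measure set R -> \bar R}) :
  ProperFilter F -> (forall M : R, \forall a \near F, M <= `|a|) ->
  Linfty V -> ess_inf_pos V -> Fval (potQ V) a @[a --> F] --> mval (potQ V) ->
  1 <= p -> Lp p mu0 ->
  (mval (fun u => potQ V u + (potQ mu0 u + measQ nup u - measQ num u)) <=
   mval (potQ V))%E.
Proof.
move=> FF Finfty LV Vpos FV p1 Lmu0; set Q := fun u => (_ + _)%E.
have [c [B [W [c0 mW cWB VW]]]] := potential_representative LV Vpos.
have B0 : 0 <= B.
  by have /andP[cW WB] := cWB 0; apply: le_trans WB; apply: le_trans cW; exact: ltW.
have m0 : (0 <= mval (potQ V))%E.
  apply: le_ereal_inf_tmp => _ [u [[mu _] _] <-]; apply: ratio_ge0.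
  rewrite VW//; apply: integral_ge0 => x _; rewrite lee_fin mulr_ge0 ?sqr_ge0//.
  by have /andP[cW _] := cWB x; apply: le_trans cW; exact: ltW.
have [->|mfin] := eqVneq (mval (potQ V)) +oo%E; first exact: leey.
have {}mfin : mval (potQ V) \is a fin_num by rewrite ge0_fin_numE// ltey.
apply/lee_addgt0Pr => e e0.
set m := fine (mval (potQ V)).
have mE : mval (potQ V) = m%:E by rewrite fineK.
(* One quarter of [e] goes to each of: near-minimality of [u], truncation, the [mu0] term and the
   [nup] term. *)
pose e4 := e / 4.
have e40 : 0 < e4 by rewrite divr_gt0.
pose t := m + e4.
(* [d] makes the truncation cost [2 * d^2 * (1 + B)] equal to [e4]. *)
pose d := Num.sqrt (e4 / (2 * (1 + B))).
have B1 : 0 < 1 + B by lra.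
have q0 : 0 < e4 / (2 * (1 + B)) by rewrite divr_gt0// mulr_gt0.
have d0 : 0 < d by rewrite sqrtr_gt0.
have dE : 2 * d ^+ 2 * (1 + B) = e4.
  by rewrite sqr_sqrtr ?(ltW q0)//; field; rewrite gt_eqF.
(* The summand 1 makes [L] positive and the bound [t / c < d^2 * L] strict. *)
pose L := `|t / c| / d ^+ 2 + 1.
have d20 : 0 < d ^+ 2 by rewrite exprn_gt0.
have L0 : 0 < L by rewrite ltr_wpDl// divr_ge0// ltW.
have tL : t / c < d ^+ 2 * L.
  rewrite /L mulrDr mulrCA divff ?gt_eqF// !mulr1.
  by rewrite (le_lt_trans (ler_norm _))// ltrDl.
pose l := 2 * (L + 1).
have l0 : 0 < l by rewrite mulr_gt0// addr_gt0.
have [M1 tail1] := Lp_tail p1 Lmu0 l0 e40.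
have nup1 : (\int[nup]_x (cst (1 : R) x)%:E < +oo)%E.
  have -> : (\int[nup]_x (cst (1 : R) x)%:E = nup setT)%E.
    by rewrite /= (integral_cst nup measurableT 1%E) mul1e.
  by rewrite ltey_eq fin_num_measure.
have [M2 tail2] := integral_tail (phi := id) (f := cst 1)
  (measurable_id (D := setT)) (measurable_cst (1 : R)) (fun=> ler01) nup1 e40.
(* Both properties hold eventually along [F]; the margin [L + 1] keeps the whole window around [a]
   beyond both tail radii. *)
have [a [aF aM]] : exists a, (Fval (potQ V) a < t%:E)%E /\ Num.max M1 M2 + (L + 1) <= `|a|.
  move: FV; rewrite mE => /fine_cvgP[fin /cvgr_lt small].
  have mt : m < t by rewrite ltrDl.
  near F => a; exists a; split; last by near: a; exact: Finfty.
  rewrite -[X in (X < _)%E]fineK; last by near: a; exact: fin.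
  by rewrite lte_fin; near: a; exact: small.
have [_ [u Ku <-] ut] : exists2 y, [set Ifun (potQ V) u | u in Kset a] y & (y < t%:E)%E.
  exact: ereal_inf_lt.
have [v [Kv v1 v0 vI]] := Kset_localize c0 mW cWB VW Ku L0 d0 ut tL.
have mv : measurable_fun setT v by case: Kv => -[].
pose b := a - (L + 1).
have far x : b <= x <= b + l -> Num.max M1 M2 <= `|x|.
  move=> xb; have : `|x - a| <= L + 1 by rewrite ler_norml; rewrite /b /l in xb; lra.
  by have := lerB_dist a (a - x); rewrite subKr distrC; lra.
have v0b x : ~~ (b <= x <= b + l) -> v x = 0.
  move=> xb; apply: v0; rewrite ltNge; apply: contra xb.
  by rewrite ler_norml /b /l; lra.
apply: (le_trans (mval_le_Kset Q Kv)).
have mu0v : (potQ mu0 v <= e4%:E)%E.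
  apply: le_trans (potQ_local_le Lmu0.1 mv v1 v0b) _; apply: tail1 => x /far.
  by rewrite ge_max => /andP[].
have nupv : (measQ nup v <= e4%:E)%E.
  apply: le_trans (measQ_local_le _ mv v1 v0b) _; apply: tail2 => // x.
  by rewrite /= in_itv/= => /far; rewrite ge_max => /andP[].
(* The negative part enters with a minus sign, so its nonnegativity is enough for an upper bound. *)
have numv : (0 <= measQ num v)%E.
  by apply: integral_ge0 => x _; rewrite lee_fin sqr_ge0.
have muv : (potQ mu0 v + measQ nup v - measQ num v <= (e4 + e4)%:E)%E.
  by apply: le_trans (leeB (leeD mu0v nupv) numv) _; rewrite sube0 EFinD.
rewrite mE -EFinD /Ifun /Q addeA.
apply: le_trans (leeD vI muv) _.
by rewrite -EFinD lee_fin dE /t /e4; lra.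
Unshelve. all: by end_near. Qed.

End Escape.

Unset Implicit Arguments.
Set Strict Implicit.

(* mu = mu0 + mu1 with mu0 in L^p and mu1 a finite signed Radon measure,
   written via its Jordan decomposition mu1 = nup - num (finite Borel measures). *)
Theorem theorem4p4 (R : realType) (V : R -> R) (p : R)
  (mu0 : R -> R) (nup num : {finite_measure set R -> \bar R}) :
  Linfty V -> ess_inf_pos V ->
  (Fval (potQ V) a @[a --> +oo] --> mval (potQ V) \/
   Fval (potQ V) a @[a --> -oo] --> mval (potQ V)) ->
  1 <= p -> Lp p mu0 ->
  (forall u, H1 u -> (0 <= potQ mu0 u + measQ nup u - measQ num u)%E) ->
  let Qmu := fun u => (potQ V u + (potQ mu0 u + measQ nup u - measQ num u))%E in
  mval Qmu = mval (potQ V) /\ Mset Qmu `<=` Mset (potQ V).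
Proof.
move=> LV Vpos FV p1 Lmu0 mu_ge0 Qmu.
have mvalE : mval Qmu = mval (potQ V).
  apply/eqP; rewrite eq_le; apply/andP; split.
    case: FV => FV; apply: mval_escape LV Vpos FV p1 Lmu0 => M.
      by near=> a; rewrite ler_normr; apply/orP; left; near: a; exact: (nbhs_pinfty_ge (num_real M)).
    near=> a; rewrite ler_normr lerNr; apply/orP; right; near: a.
    exact: (nbhs_ninfty_le (num_real (- M))).
  apply: le_ereal_inf_tmp => _ [u [Hu u0] <-].
  apply: le_trans (le_ratio (Q1 := potQ V) _); first by apply: ereal_inf_lbound; exists u.
  by rewrite leeDl// mu_ge0.
split => // u [Hu [u0 uE]]; split => //; split => //.
(* The ratio of [u] for [V] is squeezed between [mval (potQ V)] and its ratio for [Qmu], which is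
   the same number. *)
apply/eqP; rewrite eq_le; apply/andP; split.
  by rewrite -mvalE -uE; apply: le_ratio; rewrite leeDl// mu_ge0.
by apply: ereal_inf_lbound; exists u.
Unshelve. all: by end_near. Qed.
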